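(* Let $\Pi$ be a set consisting of exactly one permutation ($\#\Pi=1$). Then $Q_n(\Pi)$ is a symmetric function for all $n\ge 0$ if and only if $\Pi=\{\iota_k\}$ or $\Pi=\{\delta_k\}$ for some $k$.
   Context: $\mathfrak S_n$ is the set of permutations $\pi=\pi_1\cdots\pi_n$ of $[n]=\{1,\dots,n\}$. The standardization of a sequence of distinct reals replaces its smallest element by $1$, the next smallest by $2$, etc. A permutation $\sigma$ contains $\pi$ if some (not necessarily contiguous) subsequence of $\sigma$ standardizes to $\pi$; otherwise it avoids $\pi$. $\mathfrak S_n(\Pi)$ is the set of $\sigma\in\mathfrak S_n$ avoiding every $\pi\in\Pi$. $\iota_k=12\cdots k$ and $\delta_k=k\cdots 21$ are the increasing and decreasing permutations in $\mathfrak S_k$. The descent set of $\sigma\in\mathfrak S_n$ is $\mathrm{Des}\,\sigma=\{i\in[n-1]\mid \sigma_i>\sigma_{i+1}\}$. For $S\subseteq[n-1]$ the fundamental quasisymmetric function (of degree $n$, in variables $x_1,x_2,\dots$ with real coefficients) is $F_S=\sum x_{i_1}x_{i_2}\cdots x_{i_n}$, the sum over all $i_1\le i_2\le\cdots\le i_n$ with $i_j<i_{j+1}$ whenever $j\in S$. Define $Q_n(\Pi)=\sum_{\sigma\in\mathfrak S_n(\Pi)}F_{\mathrm{Des}\,\sigma}$. *)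

(* Defs.v *)
From mathcomp Require Import all_boot all_order all_algebra all_fingroup.
From mathcomp Require Import finmap multiset.
From mathcomp Require Import boolp classical_sets functions cardinality.
From mathcomp Require Import fsbigop reals.

Set Implicit Arguments.
Unset Strict Implicit.
Unset Printing Implicit Defensive.

Import GRing.Theory.
Local Open Scope mset_scope.
Local Open Scope classical_set_scope.

(* One-line notation, with values in {1, ..., n}; 'S_n itself permutes
   {0, ..., n-1}. *)
Definition word n (s : 'S_n) : seq nat := [seq (s i : nat).+1 | i <- enum 'I_n].

Definition standardize (s : seq nat) : seq nat :=
  [seq (index x (sort leq s)).+1 | x <- s].

Definition contains n k (s : 'S_n) (p : 'S_k) : Prop :=
  exists2 t, subseq t (word s) & standardize t = word p.

Definition permutation : Type := {k : nat & 'S_k}.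

Definition increasing k : permutation := Tagged (fun j => 'S_j) (1%g : 'S_k).

Definition decreasing k : permutation :=
  Tagged (fun j => 'S_j) (perm (@rev_ord_inj k)).

Definition avoiders n (Pi : set permutation) : set 'S_n :=
  [set s | forall p, Pi p -> ~ contains s (tagged p)].
Arguments avoiders : clear implicits.

(* Subsets of [n-1] are sets over 'I_n.-1: the ordinal i stands for the
   1-based position i + 1, hence compares entries i and i + 1 of the word
   counted from 0. *)
Definition Des n (s : 'S_n) : {set 'I_n.-1} :=
  [set i : 'I_n.-1 | nth 0 (word s) i > nth 0 (word s) i.+1]%SET.

(* A formal power series is the function giving its coefficients. A monomial
   is the multiset of the indices of its variables, which are numbered from 0
   instead of 1. *)
Definition series (R : Type) : Type := {mset nat} -> R.

Definition fund_indices n (S : {set 'I_n.-1}) : set (n.-tuple nat) :=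
  [set i | sorted leq i /\
     forall j : 'I_n.-1, j \in S -> nth 0 i j < nth 0 i j.+1].
Arguments fund_indices : clear implicits.

(* The sum over all i of the coefficient of m in the monomial
   x_(i_1) ... x_(i_n); only the sorted enumeration of m can contribute, so
   the support is finite, as the library sum requires. *)
Definition fundamental (R : realType) n (S : {set 'I_n.-1}) : series R :=
  fun m => (\sum_(i \in fund_indices n S) ((seq_mset i == m)%:R : R))%R.
Arguments fundamental : clear implicits.

Definition pattern_qsym (R : realType) n (Pi : set permutation) : series R :=
  fun m => (\sum_(s \in avoiders n Pi) fundamental R n (Des s) m)%R.
Arguments pattern_qsym : clear implicits.

Definition bounded_degree (R : realType) (f : series R) : Prop :=
  exists d, forall m, f m <> 0%R -> size m <= d.

Definition rename_vars (w : nat -> nat) (m : {mset nat}) : {mset nat} :=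
  seq_mset (map w m).

Definition symmetric_function (R : realType) (f : series R) : Prop :=
  bounded_degree f /\
  forall w : nat -> nat, bijective w -> forall m, f (rename_vars w m) = f m.

(* Main.v *)
Require Import Defs.
From mathcomp Require Import all_boot all_order all_algebra all_fingroup.
From mathcomp Require Import finmap multiset.
From mathcomp Require Import boolp classical_sets functions cardinality.
From mathcomp Require Import fsbigop reals.
From mathcomp Require Import zify.

(** Let M be the sorted word of the variable indices of a monomial of degree n.
    Its coefficient in Q_n(Pi) is the number of permutations s avoiding Pi such
    that M increases strictly at every descent of s ([pattern_qsym_coef]).
    Writing the letter M_j at position s_j turns these s into the rearrangements
    u of M, and s is recovered from u as its stable sorting permutation
    ([label_inj], [label_surj]).

    Monotone patterns give symmetric functions.  Under this bijection s contains
    the increasing (decreasing) pattern of length k exactly when u has a weakly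
    increasing (strictly decreasing) subsequence of length k ([avoids_label]).
    Hence the coefficient counts the rearrangements of M that have no such
    subsequence, and renaming the variables amounts to changing the linear order
    on the letters.  It is enough to exchange two letters a < b that are adjacent
    in the order.  For this, match every b, as an opening bracket, with a later a,
    as a closing bracket.  The unmatched letters read a...ab...b; any other
    word of this shape can be put in their place, and in particular the one with
    the two numbers of letters exchanged ([same_bracketing_exists]).  The matched
    pairs inside any interval of the word stay the same, and they determine the
    longest monotone subsequence in the letters a, b of the interval: for a
    weakly increasing one it is the number of letters minus the number of pairs,
    and a strict descent b a occurs when there is a pair.  A monotone subsequence
    uses a and b only within one interval, so its length is preserved
    ([same_bracketing_sorted]).  Exchanging the names a and b afterwards restores
    the content of the word and reverses the order of a and b
    ([num_avoiding_swap_le]).  This is the crystal reflection operator followed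
    by a relabelling.

    Conversely, let Pi = {p} with p of size n.  In size n only p itself contains
    p, so the sum of Q_n({p}) and F_(Des p) is the sum over all permutations,
    which is symmetric because it is Q_n of the increasing pattern of length
    n + 1.  So F_(Des p) is symmetric.  Its coefficient at the monomial with
    indices 0, 1, ..., j, j, j + 1, ... is 1 if j is not a descent of p and 0
    otherwise, and these monomials only differ by the names of the variables.
    Hence either every position is a descent of p, or none is. *)

Set Implicit Arguments.
Unset Strict Implicit.
Unset Printing Implicit Defensive.

(** * Bracketing of two letters *)

Section Bracketing.
Context {T : eqType} (a b : T).
Hypothesis ab_neq : b != a.

(** The letter [b] opens a bracket and [a] closes one; the unmatched [a] are
    counted from the right, so that a [b] consumes the next free [a] after it. *)
Fixpoint closers (u : seq T) : nat :=
  if u is x :: u' then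
    if x == a then (closers u').+1
    else if x == b then (closers u').-1 else closers u'
  else 0.

Fixpoint pairs (u : seq T) : nat :=
  if u is x :: u' then ((x == b) && (0 < closers u')) + pairs u' else 0.

Definition openers u := count_mem b u - pairs u.

Definition brackets (x : T) := (x == a) || (x == b).

Lemma closers_a u : closers (a :: u) = (closers u).+1.
Proof. by rewrite /= eqxx. Qed.

Lemma closers_b u : closers (b :: u) = (closers u).-1.
Proof. by rewrite /= (negbTE ab_neq) eqxx. Qed.

Lemma closers_other x u : x != a -> x != b -> closers (x :: u) = closers u.
Proof. by rewrite /= => /negbTE -> /negbTE ->. Qed.

Lemma pairs_a u : pairs (a :: u) = pairs u.
Proof. by rewrite /= eq_sym (negbTE ab_neq). Qed.

Lemma pairs_b u : pairs (b :: u) = (0 < closers u) + pairs u.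
Proof. by rewrite /= eqxx. Qed.

Lemma pairs_other x u : x != b -> pairs (x :: u) = pairs u.
Proof. by rewrite /= => /negbTE ->. Qed.

Lemma count_mem_cons x y (u : seq T) :
  count_mem x (y :: u) = (y == x) + count_mem x u.
Proof. by []. Qed.

Lemma closersD_pairs u : closers u + pairs u = count_mem a u.
Proof.
elim: u => // x u IH; have [->|xa] := eqVneq x a; last have [->|xb] := eqVneq x b.
- by rewrite closers_a pairs_a count_mem_cons eqxx -IH.
- by rewrite closers_b pairs_b count_mem_cons (negbTE ab_neq) -IH; lia.
- by rewrite closers_other // pairs_other // count_mem_cons (negbTE xa).
Qed.

Lemma pairs_le_count u : pairs u <= count_mem b u.
Proof. by elim: u => //= x u IH; lia. Qed.

Lemma openersD_pairs u : openers u + pairs u = count_mem b u.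
Proof. by rewrite /openers subnK ?pairs_le_count. Qed.

Lemma openers_a u : openers (a :: u) = openers u.
Proof. by rewrite /openers pairs_a count_mem_cons eq_sym (negbTE ab_neq). Qed.

Lemma openers_b u : openers (b :: u) = openers u + (closers u == 0).
Proof.
by rewrite /openers pairs_b count_mem_cons eqxx; have := pairs_le_count u;
   case: (closers u) => [|c] /=; lia.
Qed.

Lemma openers_other x u : x != b -> openers (x :: u) = openers u.
Proof. by move=> xb; rewrite /openers pairs_other // count_mem_cons (negbTE xb). Qed.

(** Brackets left open by [u] close against the brackets left unclosed by [v];
    together with the two lemmas below, this makes (closers, pairs, openers) a
    morphism to the bicyclic monoid with a counter of cancellations. *)
Lemma closers_cat u v : closers (u ++ v) = closers u + (closers v - openers u).
Proof.
elim: u => [|x u IH]; first by rewrite /openers /= !subn0.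
rewrite cat_cons; have [->|xa] := eqVneq x a; last have [->|xb] := eqVneq x b.
- by rewrite !closers_a openers_a IH.
- by rewrite !closers_b openers_b IH; lia.
- by rewrite !closers_other // openers_other.
Qed.

Lemma pairs_cat u v :
  pairs (u ++ v) = pairs u + pairs v + minn (openers u) (closers v).
Proof.
elim: u => [|x u IH]; first by rewrite /openers /= subn0 min0n addn0.
rewrite cat_cons; have [->|xa] := eqVneq x a; last have [->|xb] := eqVneq x b.
- by rewrite !pairs_a openers_a IH.
- by rewrite !pairs_b openers_b IH closers_cat; lia.
- by rewrite !pairs_other // openers_other.
Qed.

Lemma openers_cat u v : openers (u ++ v) = openers v + (openers u - closers v).
Proof.
rewrite {1}/openers pairs_cat count_cat -!openersD_pairs; lia.
Qed.

Definition merge_brackets x := if x == b then a else x.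

(** Comparing the numbers of pairs on all intervals says that the matched
    brackets are at the same positions, without naming these positions. *)
Definition same_bracketing u v :=
  map merge_brackets u = map merge_brackets v /\
  forall i j, pairs (take j (drop i u)) = pairs (take j (drop i v)).

Lemma same_bracketing_sym u v : same_bracketing u v -> same_bracketing v u.
Proof. by case=> m p; split. Qed.

Lemma same_bracketing_trans v u w :
  same_bracketing u v -> same_bracketing v w -> same_bracketing u w.
Proof. by case=> m p [m' p']; split=> [|i j]; rewrite ?m ?p. Qed.

Lemma same_bracketing_size u v : same_bracketing u v -> size u = size v.
Proof. by case=> /(congr1 size); rewrite !size_map. Qed.

Lemma same_bracketing_pairs u v : same_bracketing u v -> pairs u = pairs v.
Proof.
move=> uv; have := uv.2 0 (size u).
by rewrite !drop0 take_size (same_bracketing_size uv) take_size.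
Qed.

Lemma same_bracketing_behead x y u v :
  same_bracketing (x :: u) (y :: v) -> same_bracketing u v.
Proof. by case=> [[_ m] p]; split=> // i j; apply: (p i.+1 j). Qed.

(** With no [b] open at the end of [A] and no unmatched [a] in [B], a letter
    between [A] and [B] is unmatched whether it is [a] or [b], and it is so inside
    every interval. *)
Lemma same_bracketing_flip A B :
  openers A = 0 -> closers B = 0 -> same_bracketing (A ++ a :: B) (A ++ b :: B).
Proof.
move=> A0 B0; split=> [|i j].
  by rewrite !map_cat /= /merge_brackets eqxx eq_sym (negbTE ab_neq).
have flip C D : openers C = 0 -> closers D = 0 ->
    pairs (C ++ a :: D) = pairs (C ++ b :: D).
  by move=> C0 D0; rewrite !pairs_cat C0 !min0n pairs_a pairs_b D0.
have prefix n : closers (take n B) = 0.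
  by have := closers_cat (take n B) (drop n B); rewrite cat_take_drop; lia.
have suffix n : openers (drop n A) = 0.
  by have := openers_cat (take n A) (drop n A); rewrite cat_take_drop; lia.
rewrite !drop_cat; case: ltnP => [_|].
  rewrite !take_cat; case: ltnP => // _.
  by case: (j - _) => [|j']; rewrite ?take0 //=; apply: flip.
case: (i - size A) => [_|//]; rewrite !drop0.
by case: j => [|j] //=; apply: (flip [::]).
Qed.

(** The last unmatched [a]: flipping it keeps the bracketing. *)
Lemma unmatched_closer u :
  0 < closers u ->
  exists A B, [/\ u = A ++ a :: B, openers A = 0 & closers B = 0].
Proof.
elim: u => // x u IH.
have [->|xa] := eqVneq x a; last have [->|xb] := eqVneq x b.
- rewrite closers_a => _; have [u0|/IH[A [B [-> A0 B0]]]] := posnP (closers u).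
    by exists [::], u.
  by exists (a :: A), B; rewrite openers_a.
- rewrite closers_b => u2; have /IH[A [B [uE A0 B0]]] : 0 < closers u by lia.
  exists (b :: A), B; split; rewrite ?uE // openers_b A0.
  move: u2; rewrite uE closers_cat closers_a A0; lia.
- rewrite closers_other // => /IH[A [B [-> A0 B0]]].
  by exists (x :: A), B; rewrite openers_other.
Qed.

(** The first unmatched [b]: flipping it keeps the bracketing. *)
Lemma unmatched_opener u :
  0 < openers u ->
  exists A B, [/\ u = A ++ b :: B, openers A = 0 & closers B = 0].
Proof.
elim: u => // x u IH.
have [->|xa] := eqVneq x a; last have [->|xb] := eqVneq x b.
- rewrite openers_a => /IH[A [B [-> A0 B0]]].
  by exists (a :: A), B; rewrite openers_a.
- rewrite openers_b; have [u0 _|u1] := eqVneq (closers u) 0.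
    by exists [::], u.
  rewrite addn0 => /IH[A [B [uE A0 B0]]].
  exists (b :: A), B; split; rewrite ?uE // openers_b A0.
  move: u1; rewrite uE closers_cat closers_b A0 B0; lia.
- rewrite openers_other // => /IH[A [B [-> A0 B0]]].
  by exists (x :: A), B; rewrite openers_other.
Qed.

(** The words with a given bracketing form a string in which one step flips the
    last unmatched [a] or the first unmatched [b]; walking along it reaches every
    possible number of unmatched [a]. *)
Lemma same_bracketing_exists u n :
  n <= closers u + openers u ->
  exists2 v, same_bracketing u v & closers v = n.
Proof.
have rebalance A B : openers A = 0 -> closers B = 0 ->
    (closers (A ++ a :: B) = (closers (A ++ b :: B)).+1) *
    (openers (A ++ b :: B) = (openers (A ++ a :: B)).+1).
  move=> A0 B0; rewrite !closers_cat !openers_cat closers_a closers_b.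
  by rewrite openers_a openers_b A0 B0; split; lia.
move=> nu; have [le_n|gt_n] := leqP n (closers u).
  (* Too many unmatched [a]: flip the last one and recurse. *)
  elim: {u}_.+1 {-2}u (leqnn (closers u).+1) nu le_n => // k IH u.
  rewrite ltnS leq_eqVlt => uk nu; rewrite leq_eqVlt => /predU1P[->|lt_n].
    by exists u; first by split.
  have /unmatched_closer[A [B [uE A0 B0]]] : 0 < closers u by lia.
  have [rc ro] := rebalance A B A0 B0; rewrite uE in uk nu lt_n *.
  have [|||v sv vn] := IH (A ++ b :: B); try lia.
  by exists v => //; apply: same_bracketing_trans sv; apply: same_bracketing_flip.
(* Too few unmatched [a]: flip the first unmatched [b] and recurse. *)
elim: {u}_.+1 {-2}u (leqnn (openers u).+1) nu gt_n => // k IH u.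
rewrite ltnS => uk nu gt_n.
have /unmatched_opener[A [B [uE A0 B0]]] : 0 < openers u by lia.
have [rc ro] := rebalance A B A0 B0; rewrite uE in uk nu gt_n *.
have sf := same_bracketing_sym (same_bracketing_flip A0 B0).
have [eq_n|neq_n] := eqVneq n (closers (A ++ a :: B)).
  by exists (A ++ a :: B).
have [|||v sv vn] := IH (A ++ a :: B); try lia.
by exists v => //; apply: same_bracketing_trans sv.
Qed.

(** The unmatched letters read [a]...[a][b]...[b], so their positions and the
    number of [a] among them leave no choice.  By induction on the words: the
    numbers of pairs with and without the first letter tell whether a first
    letter [b] is matched. *)
Lemma same_bracketing_inj u v :
  same_bracketing u v -> closers u = closers v -> u = v.
Proof.
elim: u v => [|x u IH] [|y v] uv; do ?by case: uv => [].
have uv' := same_bracketing_behead uv.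
have := same_bracketing_pairs uv; have := same_bracketing_pairs uv'.
have : merge_brackets x = merge_brackets y by case: uv => -[].
rewrite /merge_brackets.
have [->|xb] := eqVneq x b; have [->|yb] := eqVneq y b.
- move=> _; rewrite !pairs_b !closers_b => p0 p1 cl.
  by rewrite (IH v) //; lia.
- by move<-; rewrite pairs_a pairs_b closers_a closers_b; lia.
- by move->; rewrite pairs_a pairs_b closers_a closers_b; lia.
- move->; rewrite /= (negbTE yb); case: ifP => _ _ _ cl; rewrite (IH v) //.
  by case: cl.
Qed.

Lemma count_brackets u : count brackets u = closers u + openers u + (pairs u).*2.
Proof.
have -> : count brackets u = count_mem a u + count_mem b u.
  elim: u => //= x u ->; rewrite /brackets.
  by case: eqP => [->|_] /=; rewrite 1?eq_sym ?(negbTE ab_neq); lia.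
by rewrite -closersD_pairs -openersD_pairs; lia.
Qed.

(** In a subsequence [a]...[a][b]...[b] each matched pair, being [b] before
    [a], loses one of its two letters. *)
Lemma increasing_bound u i j :
  subseq (nseq i a ++ nseq j b) u -> i + j <= closers u + openers u + pairs u.
Proof.
elim: u i j => [|x u IH] i j; first by case: i => //; case: j.
have [->|xa] := eqVneq x a; last have [->|xb] := eqVneq x b.
- rewrite closers_a openers_a pairs_a; case: i => [|i].
    case: j => //= j; rewrite (negbTE ab_neq) => /(IH 0 j.+1); lia.
  by rewrite /= eqxx => /IH; lia.
- case: i => [|i]; last first.
    rewrite /= (eq_sym a) (negbTE ab_neq) => /(IH i.+1 j).
    by rewrite eqxx /= openers_b; case: (closers u) => [|c] /=; lia.
  rewrite cat0s => /(leq_count_subseq (pred1 b)); rewrite count_nseq.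
  rewrite count_mem_cons [pred1 b b]/= !eqxx mul1n.
  rewrite openers_b closers_b pairs_b -openersD_pairs.
  by case: (closers u) => [|c] /=; lia.
- by rewrite closers_other // openers_other // pairs_other //; case: i => [|i];
  [case: j => //= j|]; rewrite /= ?(eq_sym b) ?(eq_sym a) ?(negbTE xa) ?(negbTE xb) => ss;
  [apply: (IH 0 j.+1)|apply: (IH i.+1 j)].
Qed.

(** Adding letters in front, only a new [b] with no [a] to match it needs care:
    then all the [b] together already attain the bound of [increasing_bound]. *)
Lemma increasing_reached u :
  exists i j, subseq (nseq i a ++ nseq j b) u /\
    i + j = closers u + openers u + pairs u.
Proof.
elim: u => [|x u [i [j [ss ij]]]]; first by exists 0, 0.
have [->|xa] := eqVneq x a; last have [->|xb] := eqVneq x b.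
- exists i.+1, j; rewrite /= eqxx; split=> //.
  by rewrite openers_a (eq_sym a) (negbTE ab_neq); lia.
- have [u0|u1] := posnP (closers u).
    exists 0, (count_mem b u).+1; split.
      rewrite /= eqxx; have/all_pred1P := filter_all (pred1 b) u.
      by rewrite size_filter => <-; apply: filter_subseq.
    rewrite openers_b closers_b pairs_b u0 -openersD_pairs; lia.
  exists i, j; split; first by apply: subseq_trans ss (subseq_cons _ _).
  by rewrite openers_b closers_b pairs_b; case: (closers u) u1 ij => //= c _; lia.
- exists i, j; split; first by apply: subseq_trans ss (subseq_cons _ _).
  by rewrite closers_other // openers_other // pairs_other.
Qed.

(** An innermost [b] before [a] is always matched. *)
Lemma pairs_gt0 u : (0 < pairs u) = subseq [:: b; a] u.
Proof.
elim: u => // x u IH.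
have [->|xa] := eqVneq x a; last have [->|xb] := eqVneq x b.
- by rewrite pairs_a IH /= (negbTE ab_neq).
- rewrite pairs_b addn_gt0 lt0b /= eqxx sub1seq IH.
  rewrite -has_pred1 has_count -closersD_pairs addn_gt0 IH; case: (0 < _) => //=.
- by rewrite pairs_other // IH /= eq_sym (negbTE xb).
Qed.

Lemma merge_count u v :
  map merge_brackets u = map merge_brackets v -> count brackets u = count brackets v.
Proof.
have merge_count w : count brackets w = count_mem a (map merge_brackets w).
  rewrite count_map; apply: eq_count => x /=; rewrite /merge_brackets.
  by rewrite /brackets; case: (eqVneq x b) => [_|_]; rewrite ?eqxx ?orbT ?orbF.
by rewrite !merge_count => ->.
Qed.

Lemma merge_filter u v :
  map merge_brackets u = map merge_brackets v ->
  filter (predC brackets) u = filter (predC brackets) v.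
Proof.
elim: u v => [|x u IH] [|y v] //= [xy /IH ->]; move: xy.
rewrite /merge_brackets /brackets.
have [->|xb] := eqVneq x b; have [->|yb] := eqVneq y b => //.
- by move<-; rewrite eqxx orbT.
- by move->; rewrite eqxx orbT.
- by move->.
Qed.

(** For [dec = false] the relation [r] is a weak order with [a] before [b], for
    [dec = true] it is the strict order with [b] before [a]. *)
Context (dec : bool) (r : rel T).
Hypothesis r_trans : transitive r.
Hypothesis r_brackets : forall x y, brackets x -> brackets y ->
  r x y = dec (+) ((x == a) || (y == b)).
Hypothesis r_other : forall x, ~~ brackets x ->
  [/\ r x a = r x b, r a x = r b x & ~~ (r a x && r x a)].

Lemma brackets_a : brackets a. Proof. by rewrite /brackets eqxx. Qed.
Lemma brackets_b : brackets b. Proof. by rewrite /brackets eqxx orbT. Qed.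

Lemma sorted_brackets_weak t :
  dec = false -> all brackets t -> sorted r t ->
  exists i j, t = nseq i a ++ nseq j b.
Proof.
move=> dec0; elim: t => [|x t IH] /=; first by exists 0, 0.
case/andP=> /orP[] /eqP-> t_ab pt.
  have [i [j ->]] := IH t_ab (path_sorted pt).
  by exists i.+1, j.
exists 0, (size t).+1; congr (_ :: _); apply/all_pred1P/allP => y yt /=.
have := allP (order_path_min r_trans pt) y yt.
rewrite r_brackets ?brackets_b ?dec0 ?(negbTE ab_neq) //; exact: (allP t_ab).
Qed.

Lemma sorted_brackets_strict t :
  dec -> all brackets t -> sorted r t -> 1 < size t -> t = [:: b; a].
Proof.
move=> dec1; case: t => [//|x [//|y t]] /and3P[xP yP tP] /=.
rewrite r_brackets // dec1 addTb negb_or => /andP[/andP[xa yb]].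
have -> : x = b by apply/eqP; move: xP; rewrite /brackets (negbTE xa).
have -> : y = a by apply/eqP; move: yP; rewrite /brackets (negbTE yb) orbF.
case: t tP => [//|z t] /andP[zP _] /andP[].
by rewrite r_brackets ?brackets_a // dec1 eqxx.
Qed.

(** Inside one interval, the number of letters and the number of pairs determine
    how long a monotone subsequence in the letters [a], [b] can be. *)
Lemma subseq_sorted_slice u v t :
    map merge_brackets u = map merge_brackets v -> pairs u = pairs v ->
    all brackets t -> sorted r t -> subseq t u ->
  exists t', [/\ all brackets t', sorted r t', subseq t' v & size t' = size t].
Proof.
move=> muv puv tP ts tu; have cuv := merge_count muv.
case: (boolP dec) => [dec1|/negbTE dec0].
  have [t1|t_small] := ltnP 1 (size t).
    have tE := sorted_brackets_strict dec1 tP ts t1.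
    exists t; split=> //.
    by rewrite tE -pairs_gt0 -puv pairs_gt0 -tE.
  case: t tP {ts} tu t_small => [|x [|//]] xP xu _.
    by exists [::]; rewrite sub0seq.
  have : has brackets v.
    rewrite has_count -cuv -has_count; apply/hasP; exists x.
      by rewrite -sub1seq.
    by case/andP: xP.
  by case/hasP=> y yv yP; exists [:: y]; rewrite /= yP sub1seq yv.
have [i [j tE]] := sorted_brackets_weak dec0 tP ts.
have [i' [j' [t'v ij']]] := increasing_reached v.
have le_t : size t <= i' + j'.
  rewrite tE size_cat !size_nseq ij'; have := increasing_bound (i := i) (j := j).
  move=> /(_ u); rewrite -tE => /(_ tu).
  by move: cuv; rewrite !count_brackets puv; lia.
set t' := nseq i' a ++ nseq j' b in t'v.
have t'P : all brackets t' by rewrite all_cat !all_nseq brackets_a brackets_b !orbT.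
exists (take (size t) t'); split.
- by apply/allP => x /mem_take; apply: (allP t'P).
- apply: (@subseq_sorted _ _ r_trans _ t'); first exact: take_subseq.
  rewrite sorted_pairwise // pairwise_cat; apply/and3P; split.
  + apply/allrelP => x y /nseqP[-> _] /nseqP[-> _].
    by rewrite r_brackets ?brackets_a ?brackets_b // eqxx dec0.
  + elim: (i') => //= n ->; rewrite all_nseq r_brackets ?brackets_a //.
    by rewrite eqxx dec0 orbT.
  + elim: (j') => //= n ->; rewrite all_nseq r_brackets ?brackets_b //.
    by rewrite eqxx dec0 !orbT.
- exact: subseq_trans (take_subseq _ _) t'v.
- by rewrite size_takel // size_cat !size_nseq.
Qed.

Lemma r_outside x y z : ~~ brackets x -> brackets y -> brackets z ->
  (r x y = r x z) * (r y x = r z x).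
Proof.
by move=> /r_other[e1 e2 _] /orP[] /eqP-> /orP[] /eqP->; rewrite ?e1 ?e2.
Qed.

(** No other letter lies between [a] and [b] in the order, so a monotone
    sequence uses these two letters in one block. *)
Lemma sorted_brackets_contiguous t :
  sorted r t -> exists t1 t2 t3,
  [/\ t = t1 ++ t2 ++ t3, all (predC brackets) t1, all brackets t2
     & all (predC brackets) t3].
Proof.
rewrite sorted_pairwise //; elim: t => [|x t IH] /=.
  by exists [::], [::], [::].
case/andP=> xt IHp; have [t1 [t2 [t3 [tE t1P t2P t3P]]]] := IH IHp.
have [xP|xP] := boolP (brackets x); last by exists (x :: t1), t2, t3; rewrite tE /= xP.
case: t2 tE t2P => [|z t2] tE t2P.
  by exists [::], [:: x], t; rewrite tE /= all_cat t1P xP.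
case: t1 tE t1P => [|y t1] tE t1P.
  by exists [::], (x :: z :: t2), t3; rewrite tE /= xP.
case/andP: t1P => yP _; have [_ _ /negP[]] := r_other yP.
have zP : brackets z by case/andP: t2P.
rewrite -(r_outside yP zP brackets_a).1 -(r_outside yP xP brackets_a).2.
move: IHp xt; rewrite tE /= => /andP[/allP yt _] /andP[-> _]; apply: yt.
by rewrite mem_cat inE eqxx orbT.
Qed.

Lemma sorted_cat3 t1 t2 t3 t2' :
    all (predC brackets) t1 -> all (predC brackets) t3 ->
    all brackets t2 -> all brackets t2' -> size t2' = size t2 ->
    sorted r t2' -> sorted r (t1 ++ t2 ++ t3) -> sorted r (t1 ++ t2' ++ t3).
Proof.
move=> t1P t3P t2P t2'P eq_sz.
rewrite !sorted_pairwise // !pairwise_cat !allrel_catr.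
move=> -> /and3P[/andP[t12 t13] -> /and3P[t23 _ ->]]; rewrite t13 !andbT /=.
have replace y : y \in t2' -> exists2 z, z \in t2 & brackets z.
  case: t2 t2P eq_sz {t12 t23} => [|z t2] /= => [_ /size0nil-> //|].
  by case/andP=> zP _ _ _; exists z; rewrite ?mem_head.
apply/andP; split; apply/allrelP => x y.
  move=> xt yt; have [z zt zP] := replace _ yt.
  rewrite (r_outside (allP t1P _ xt) (allP t2'P _ yt) zP).1.
  exact: (allrelP t12).
move=> xt yt; have [z zt zP] := replace _ xt.
rewrite (r_outside (allP t3P _ yt) (allP t2'P _ xt) zP).2.
exact: (allrelP t23).
Qed.

Lemma subseq_catl (s1 s2 u : seq T) :
  subseq (s1 ++ s2) u ->
  exists n, subseq s1 (take n u) /\ subseq s2 (drop n u).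
Proof.
elim: u s1 s2 => [|x u IH] [|y s1] s2 //=; try by exists 0.
case: ifP => [yx|yx] /=.
  by case/IH=> n [ss1 ss2]; exists n.+1; rewrite /= yx.
by case/(IH (y :: s1) s2)=> n [ss1 ss2]; exists n.+1; rewrite /= yx.
Qed.

Lemma subseq_outside u v t :
  map merge_brackets u = map merge_brackets v ->
  all (predC brackets) t -> subseq t u -> subseq t v.
Proof.
move=> /merge_filter muv tP tu; apply: subseq_trans (filter_subseq (predC brackets) v).
by rewrite -muv subseq_filter tP.
Qed.

(** Only the block of letters [a], [b] of the subsequence has to be moved, and
    it lies in an interval of the word that the other letters of the subsequence
    leave free. *)
Lemma same_bracketing_sorted u v t :
    same_bracketing u v -> sorted r t -> subseq t u ->
  exists t', [/\ sorted r t', subseq t' v & size t' = size t].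
Proof.
move=> uv ts; have [t1 [t2 [t3 [tE t1P t2P t3P]]]] := sorted_brackets_contiguous ts.
rewrite tE => /subseq_catl[i [t1u /subseq_catl[j [t2u t3u]]]].
have [muv puv] := uv.
have ts2 : sorted r t2.
  by move: ts; rewrite tE !sorted_pairwise // !pairwise_cat => /and3P[_ _ /and3P[]].
have [|t2' [t2'P t2's t2'v eq_sz]] :=
    @subseq_sorted_slice _ (take j (drop i v)) t2 _ (puv i j) t2P ts2 t2u.
  by rewrite !map_take !map_drop muv.
exists (t1 ++ t2' ++ t3); split.
- by apply: (@sorted_cat3 t1 t2) => //; rewrite -tE.
- rewrite -(cat_take_drop i v); apply: cat_subseq.
    by apply: subseq_outside t1u => //; rewrite !map_take muv.
  rewrite -(cat_take_drop j (drop i v)); apply: cat_subseq => //.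
  by apply: subseq_outside t3u => //; rewrite !map_drop muv.
- by rewrite !size_cat eq_sz.
Qed.
End Bracketing.

(** * Counting words without long monotone subsequences *)

Definition swap (T : eqType) (a b x : T) :=
  if x == a then b else if x == b then a else x.

Lemma swapK (T : eqType) (a b : T) : involutive (swap a b).
Proof.
move=> x; rewrite /swap; have [->|xa] := eqVneq x a.
  by rewrite eqxx; case: eqVneq.
by have [->|xb] := eqVneq x b; rewrite ?eqxx // (negbTE xa) (negbTE xb).
Qed.

(** Bubble sort: adjacent transpositions bring the letters of [L1], one after the
    other, to the front of what remains of [L2]. *)
Lemma adjacent_swap_invariant (T : eqType) (X : Type) (F : seq T -> X) :
    (forall p a b q, uniq (p ++ a :: b :: q) ->
      F (p ++ a :: b :: q) = F (p ++ b :: a :: q)) ->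
  forall L1 L2, uniq L1 -> perm_eq L1 L2 -> F L1 = F L2.
Proof.
move=> swapF.
have to_front p x q1 q2 : uniq (p ++ q1 ++ x :: q2) ->
    F (p ++ q1 ++ x :: q2) = F (p ++ x :: q1 ++ q2).
  elim/last_ind: q1 q2 => [//|q1 y IH] q2; rewrite -cats1 -!catA /= => uL.
  have -> : F (p ++ q1 ++ y :: x :: q2) = F (p ++ q1 ++ x :: y :: q2).
    by rewrite catA swapF -catA.
  apply: IH; rewrite (perm_uniq (_ : perm_eq _ (p ++ q1 ++ y :: x :: q2))) //.
  by rewrite !perm_cat2l -[x :: _]/([:: x] ++ [:: y] ++ q2) perm_catCA.
suff inv L1 : forall p L2, uniq (p ++ L1) -> perm_eq L1 L2 ->
    F (p ++ L1) = F (p ++ L2) by move=> L1 L2 uL /(inv L1 [::] L2); apply.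
elim: L1 => [|x L1 IH] p L2 uL.
  by rewrite perm_sym => /perm_nilP->.
move=> perm12; have xL2 : x \in L2 by rewrite -(perm_mem perm12) mem_head.
move: perm12; case/path.splitP: xL2 => q1 q2; rewrite cat_rcons => perm12.
rewrite to_front; last first.
  by rewrite -(perm_uniq (_ : perm_eq (p ++ x :: L1) _)) // perm_cat2l.
rewrite -!cat_rcons; apply: IH; first by rewrite cat_rcons.
by rewrite -(perm_cons x) (perm_trans perm12) // -[x :: _]cat1s perm_catCA.
Qed.

Definition avoids (T : eqType) (r : rel T) k (u : seq T) : bool :=
  ~~ `[< exists t, [/\ sorted r t, subseq t u & size t = k] >].

Definition num_avoiding (T : eqType) (r : rel T) k (s : seq T) : nat :=
  count (avoids r k) (permutations s).

(** The order of letters given by a list, weakly increasing for [dec = false]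
    and strictly decreasing for [dec = true]; the negation of the weak order is
    the strict order in the other direction because ranks are totally ordered. *)
Definition by_rank (T : eqType) dec (L : seq T) : rel T :=
  fun x y => dec (+) (index x L <= index y L).

Lemma by_rank_trans (T : eqType) dec (L : seq T) : transitive (by_rank dec L).
Proof. by rewrite /by_rank; case: dec => y x z /=; lia. Qed.

Lemma avoids_map (T T' : eqType) (w : T -> T') (r : rel T') k u :
  avoids r k (map w u) = avoids (relpre w r) k u.
Proof.
congr (~~ _); apply/asboolP/asboolP => -[t [ts tu tk]].
  have [m sm tE] := subseqP tu; exists (mask m u).
  split; first by rewrite -sorted_map map_mask -tE.
    exact: mask_subseq.
  by rewrite -tk tE -map_mask size_map.
by exists (map w t); rewrite sorted_map map_subseq // size_map.
Qed.

Lemma eq_avoids (T : eqType) (r r' : rel T) k u :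
  {in u &, r =2 r'} -> avoids r k u = avoids r' k u.
Proof.
move=> rr'; congr (~~ _); apply/asboolP/asboolP => -[t [ts tu tk]]; exists t;
  split=> //; have t_u : all (mem u) t by apply/allP => x /(mem_subseq tu).
  by rewrite -(eq_in_sorted rr').
by rewrite (eq_in_sorted rr').
Qed.

(** The injection sends a word to the word with the same bracketing and the
    numbers of unmatched [a] and [b] exchanged, in which then [a] and [b] trade
    their names.  Since the matched letters come in pairs, the content is that of
    the original word. *)
Lemma num_avoiding_swap_le (T : eqType) dec k (s p q : seq T) a b :
    uniq (p ++ a :: b :: q) ->
  num_avoiding (by_rank dec (p ++ a :: b :: q)) k s <=
  num_avoiding (by_rank dec (p ++ b :: a :: q)) k s.
Proof.
set L := p ++ a :: b :: q; set L' := p ++ b :: a :: q => uL.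
have ab_neq : b != a.
  by move: uL; rewrite cat_uniq => /and3P[_ _ /andP[]]; rewrite inE negb_or eq_sym => /andP[].
have [ap bp] : a \notin p /\ b \notin p.
  move: uL; rewrite cat_uniq /= => /and3P[_ /norP[pa /norP[pb _]] _].
  by [].
pose i := size p.
have ia : index a L = i by rewrite index_cat (negbTE ap) /= eqxx addn0.
have ib : index b L = i.+1.
  by rewrite index_cat (negbTE bp) /= eq_sym (negbTE ab_neq) eqxx addn1.
have io x : ~~ brackets a b x -> (index x L == i) || (index x L == i.+1) = false.
  case/norP=> xa xb; rewrite index_cat; case: ifP => [|_] /=.
    by rewrite -index_mem /i; lia.
  by rewrite (eq_sym a) (negbTE xa) (eq_sym b) (negbTE xb) /i; lia.
have index_swap x : index (swap a b x) L' = index x L.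
  rewrite /swap; have [->|xa] := eqVneq x a.
    by rewrite index_cat (negbTE bp) /= eqxx addn0.
  have [->|xb] := eqVneq x b.
    by rewrite index_cat (negbTE ap) /= (negbTE ab_neq) eqxx addn1.
  by rewrite !index_cat /= !(eq_sym _ x) (negbTE xa) (negbTE xb).
have r_brackets x y : brackets a b x -> brackets a b y ->
    by_rank dec L x y = dec (+) ((x == a) || (y == b)).
  rewrite /by_rank => /orP[] /eqP-> /orP[] /eqP->; rewrite ?ia ?ib ?eqxx ?leqnn.
  - by [].
  - by rewrite leqnSn.
  - by rewrite ltnn (negbTE ab_neq) eq_sym (negbTE ab_neq).
  - by rewrite orbT.
have r_other x : ~~ brackets a b x ->
    [/\ by_rank dec L x a = by_rank dec L x b,
        by_rank dec L a x = by_rank dec L b x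
      & ~~ (by_rank dec L a x && by_rank dec L x a)].
  by move/io; rewrite /by_rank ia ib; case: (dec); split; lia.
(* [rho] exchanges the numbers of unmatched [a] and [b]. *)
have /choice[rho rhoP] u : exists v,
    same_bracketing a b u v /\ closers a b v = openers a b u.
  have [|v uv vc] := same_bracketing_exists ab_neq (u := u) (n := openers a b u).
    exact: leq_addl.
  by exists v.
have rho_openers u : openers a b (rho u) = closers a b u.
  have [uv vc] := rhoP u; have := merge_count uv.1.
  by rewrite !count_brackets // vc (same_bracketing_pairs uv); lia.
pose phi u := map (swap a b) (rho u).
have phi_inj : injective phi.
  move=> u u' /(inj_map (inv_inj (swapK a b))) eq_rho.
  have [uv vc] := rhoP u; have [uv' vc'] := rhoP u'.
  apply: (same_bracketing_inj ab_neq).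
    by apply: same_bracketing_trans uv _; rewrite eq_rho; apply: same_bracketing_sym.
  by rewrite -!rho_openers eq_rho.
have phi_perm u : perm_eq (phi u) u.
  have [uv vc] := rhoP u; apply/allP => x _; apply/eqP; rewrite /= count_map.
  have -> : count (preim (swap a b) (pred1 x)) (rho u) = count_mem (swap a b x) (rho u).
    by apply: eq_count => y /=; rewrite (can2_eq (swapK a b) (swapK a b)).
  rewrite /swap; have [->|xa] := eqVneq x a.
    rewrite -(openersD_pairs ab_neq) rho_openers -(same_bracketing_pairs uv).
    exact: (closersD_pairs ab_neq).
  have [->|xb] := eqVneq x b.
    by rewrite -(closersD_pairs ab_neq) vc -(same_bracketing_pairs uv) (openersD_pairs ab_neq).
  have /(congr1 (count_mem x)) := merge_filter uv.1.
  rewrite !count_filter => eq_c.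
  have only_x v : count_mem x v = count (predI (pred1 x) (predC (brackets a b))) v.
    apply: eq_count => y /=; have [->|//] := eqVneq y x.
    by rewrite /brackets (negbTE xa) (negbTE xb).
  by rewrite !only_x eq_c.
have phi_avoids u : avoids (by_rank dec L) k u -> avoids (by_rank dec L') k (phi u).
  rewrite /phi avoids_map.
  rewrite (@eq_avoids _ _ (by_rank dec L)); last first.
    by move=> x y _ _; rewrite /= /by_rank !index_swap.
  apply: contra => /asboolP[t [ts tv tk]]; apply/asboolP.
  have [t' [t's t'u t'k]] := same_bracketing_sorted ab_neq (@by_rank_trans _ dec L)
    r_brackets r_other (same_bracketing_sym (rhoP u).1) ts tv.
  by exists t'; rewrite t'k.
rewrite /num_avoiding -!size_filter -(size_map phi); apply: uniq_leq_size.
  by rewrite map_inj_uniq // filter_uniq // permutations_uniq.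
move=> v /mapP[u]; rewrite mem_filter mem_permutations => /andP[ua us] ->.
by rewrite mem_filter mem_permutations phi_avoids // (perm_trans (phi_perm u)).
Qed.

Lemma num_avoiding_rank (T : eqType) dec k (s L1 L2 : seq T) :
  uniq L1 -> perm_eq L1 L2 ->
  num_avoiding (by_rank dec L1) k s = num_avoiding (by_rank dec L2) k s.
Proof.
apply: (adjacent_swap_invariant (F := fun L => num_avoiding (by_rank dec L) k s)).
move=> p a b q uL; apply/eqP; rewrite eqn_leq !num_avoiding_swap_le //.
rewrite -(perm_uniq (_ : perm_eq (p ++ a :: b :: q) _)) //.
by rewrite perm_cat2l -[a :: _]/([:: a] ++ [:: b] ++ q) perm_catCA.
Qed.

Definition monotone dec : rel nat := fun x y => dec (+) (x <= y).

Lemma index_sort (T : eqType) (g : T -> nat) (s : seq T) :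
  injective g ->
  {in s &, forall x y,
    (index x (sort (relpre g leq) (undup s)) <= index y (sort (relpre g leq) (undup s)))
    = (g x <= g y)}.
Proof.
move=> g_inj x y xs ys; set L := sort _ _.
have sortedL : sorted (relpre g leq) L by apply: sort_sorted => ? ?; apply: leq_total.
have tr : transitive (relpre g leq) by move=> ? ? ?; apply: leq_trans.
have [xL yL] : x \in L /\ y \in L by rewrite !mem_sort !mem_undup.
apply/idP/idP => [|le_xy].
  by apply: (sorted_leq_index tr _ sortedL) => // ?; apply: leqnn.
rewrite leqNgt; apply/negP => lt_yx.
have le_yx := sorted_ltn_index tr sortedL _ _ yL xL lt_yx.
have xy : x = y by apply: g_inj; apply/eqP; rewrite eqn_leq le_xy.
by rewrite xy ltnn in lt_yx.
Qed.

Lemma num_avoiding_order dec k (T : eqType) (g g' : T -> nat) s :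
  injective g -> injective g' ->
  num_avoiding (relpre g (monotone dec)) k s = num_avoiding (relpre g' (monotone dec)) k s.
Proof.
move=> g_inj g'_inj.
have toL h : injective h -> num_avoiding (relpre h (monotone dec)) k s =
    num_avoiding (by_rank dec (sort (relpre h leq) (undup s))) k s.
  move=> h_inj; apply: eq_in_count => u; rewrite mem_permutations => us.
  apply: eq_avoids => x y xu yu; rewrite /by_rank index_sort //.
    by rewrite -(perm_mem us).
  by rewrite -(perm_mem us).
rewrite (toL g) // (toL g') //; apply: num_avoiding_rank; first by rewrite sort_uniq undup_uniq.
by rewrite perm_sort perm_sym perm_sort.
Qed.

(** A renaming of the letters is a change of their order, pulled back along
    [w]; on the finitely many letters of [s] both orders are given by lists. *)
Lemma num_avoiding_rename dec k (w : nat -> nat) s :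
  injective w ->
  num_avoiding (monotone dec) k (map w s) = num_avoiding (monotone dec) k s.
Proof.
move=> w_inj.
have perm_w : perm_eq (permutations (map w s)) (map (map w) (permutations s)).
  apply: uniq_perm; first exact: permutations_uniq.
    by rewrite map_inj_uniq ?permutations_uniq //; apply: inj_map.
  move=> u; rewrite mem_permutations; apply/idP/mapP.
    case/(perm_iotaP 0) => m; rewrite size_map => mi ->.
    exists (map (nth 0 s) m); first by rewrite mem_permutations; apply/(perm_iotaP 0); exists m.
    rewrite -map_comp; apply/eq_in_map => i; rewrite (perm_mem mi) mem_iota => im.
    by rewrite (nth_map 0).
  by case=> v; rewrite mem_permutations => vs ->; apply: perm_map.
transitivity (num_avoiding (relpre w (monotone dec)) k s).
  rewrite /num_avoiding (seq.permP perm_w) count_map.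
  by apply: eq_count => u /=; rewrite avoids_map.
exact: (@num_avoiding_order dec k _ w id s w_inj (fun _ _ => id)).
Qed.

(** * Words and their stable sorting permutations *)

Lemma sorted_index_subseq (T : eqType) (s t : seq T) :
    uniq s -> {subset t <= s} ->
  sorted ltn (map (index^~ s) t) = subseq t s.
Proof.
move=> us ts; rewrite sorted_map; set r := relpre _ _.
have r_trans : transitive r by move=> y x z; apply: ltn_trans.
have sorted_s : sorted r s.
  have [->//|[x0 _]] : s = [::] \/ exists x0, x0 \in s.
    by case: (s) => [|x0 ?]; [left | right; exists x0; apply: mem_head].
  by apply/(sortedP x0) => i lt_i /=; rewrite !index_uniq // ltnW.
apply/idP/idP => [sorted_t|]; last by move/subseq_sorted; apply.
suff -> : t = filter (mem t) s by apply: filter_subseq.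
apply: (irr_sorted_eq r_trans) => //.
- by move=> x; apply: ltnn.
- exact: sorted_filter.
- by move=> x; rewrite mem_filter /= andb_idr // => /ts.
Qed.

Lemma subseq_iota q n :
  subseq q (iota 0 n) = sorted ltn q && all (gtn n) q.
Proof.
apply/idP/andP => [qn|[sq qn]].
  split; first exact: (subseq_sorted ltn_trans qn (iota_ltn_sorted _ _)).
  by apply/allP => x /(mem_subseq qn); rewrite mem_iota.
rewrite -sorted_index_subseq ?iota_uniq //; last first.
  by move=> x /(allP qn); rewrite mem_iota.
rewrite (_ : map _ q = q) // -[RHS]map_id; apply/eq_in_map => x /(allP qn) /= xn.
by rewrite -{1}(etrans (nth_iota 0 0 xn) (add0n x)) index_uniq ?size_iota ?iota_uniq.
Qed.

Lemma sorted_monotone dec t : uniq t ->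
  sorted (monotone dec) t = sorted ltn (if dec then rev t else t).
Proof.
move=> ut; case: dec; last by rewrite ltn_sorted_uniq_leq ut; apply: eq_sorted.
by rewrite rev_sorted; apply: eq_sorted => x y; rewrite /monotone /= ltnNge.
Qed.

Lemma mem_dir (T : eqType) dec (t : seq T) : (if dec then rev t else t) =i t.
Proof. by case: dec => // x; rewrite mem_rev. Qed.

Lemma size_dir (T : eqType) dec (t : seq T) : size (if dec then rev t else t) = size t.
Proof. by case: dec => //; rewrite size_rev. Qed.

Lemma sorted_by_rank (dec : bool) (s t : seq nat) : uniq t -> {subset t <= s} ->
  sorted (by_rank dec s) t = sorted ltn (map (index^~ s) (if dec then rev t else t)).
Proof.
move=> ut ts; have -> : sorted (by_rank dec s) t = sorted (monotone dec) (map (index^~ s) t).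
  by rewrite sorted_map.
rewrite sorted_monotone; first by case: dec; rewrite ?map_rev.
by rewrite map_inj_in_uniq // => x y xt yt; apply: (index_inj x (ts _ xt) (ts _ yt)).
Qed.

(** A monotone subsequence of [s] is, up to reversal, an increasing sequence of
    values whose positions are monotone: this is the passage from a permutation
    to its inverse, which preserves monotone patterns. *)
Lemma avoids_inverse dec k n s :
  perm_eq s (iota 0 n) ->
  avoids (monotone dec) k s = avoids (by_rank dec s) k (iota 0 n).
Proof.
move=> sn; have us : uniq s by rewrite (perm_uniq sn) iota_uniq.
have ltns x : (x \in s) = (x < n) by rewrite (perm_mem sn) mem_iota.
congr (~~ _); apply/asboolP/asboolP => -[t [st ts tk]];
  exists (if dec then rev t else t); rewrite size_dir.
  have ut : uniq t := subseq_uniq ts us.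
  have sub x : x \in t -> x \in s by apply: mem_subseq.
  split=> //; last first.
    rewrite subseq_iota -sorted_monotone // st /=.
    by apply/allP => x; rewrite mem_dir /= -ltns => /sub.
  rewrite sorted_by_rank; last by move=> x; rewrite mem_dir => /sub.
    by case: dec {st}; rewrite ?revK sorted_index_subseq.
  by case: dec {st}; rewrite ?rev_uniq.
have ut : uniq t by apply: subseq_uniq ts (iota_uniq _ _).
have sub x : x \in t -> x \in s by move/(mem_subseq ts); rewrite mem_iota ltns.
move: ts; rewrite subseq_iota => /andP[t_inc _].
split=> //.
  rewrite sorted_monotone; first by case: dec {st}; rewrite ?revK.
  by case: dec {st}; rewrite ?rev_uniq.
by rewrite -sorted_index_subseq ?sorted_by_rank // -?sorted_by_rank // => x;
  rewrite mem_dir => /sub.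
Qed.

(** The word whose letter at position [s_j] is [M_j]. *)
Definition label (M s : seq nat) := [seq nth 0 M (index x s) | x <- iota 0 (size s)].

Definition compatible (M s : seq nat) :=
  all (fun j => (nth 0 s j.+1 < nth 0 s j) ==> (nth 0 M j < nth 0 M j.+1))
      (iota 0 (size s).-1).

Definition stable_le (u : seq nat) : rel nat :=
  fun x y => (nth 0 u x < nth 0 u y) || (nth 0 u x == nth 0 u y) && (x <= y).

Lemma stable_le_trans u : transitive (stable_le u).
Proof. by move=> y x z; rewrite /stable_le; lia. Qed.

Lemma stable_le_anti u : antisymmetric (stable_le u).
Proof. by move=> x y; rewrite /stable_le; lia. Qed.

Lemma stable_le_total u : total (stable_le u).
Proof. by move=> x y; rewrite /stable_le; lia. Qed.

Lemma nth_label n M s x : size s = n -> x < n -> nth 0 (label M s) x = nth 0 M (index x s).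
Proof. by move=> sn xn; rewrite (nth_map 0) ?size_iota ?sn // nth_iota. Qed.

Lemma compatibleP n M s : size s = n ->
  reflect (forall j, j.+1 < n -> nth 0 s j.+1 < nth 0 s j -> nth 0 M j < nth 0 M j.+1)
    (compatible M s).
Proof.
move=> sn; apply: (iffP allP) => [H j jn|H j]; rewrite ?mem_iota ?sn => jn'.
  by apply: (implyP (H j _)) => //; rewrite mem_iota sn; lia.
by apply/implyP; apply: H; lia.
Qed.

Section Standardization.
Context (n : nat) (M : seq nat).
Hypotheses (M_sorted : sorted leq M) (M_size : size M = n).

(** Where [M] is constant, compatibility makes [s] increase, so [s] lists the
    positions of the word by letter and, within one letter, from left to right. *)
Lemma compatible_sorted s : perm_eq s (iota 0 n) -> compatible M s ->
  sorted (stable_le (label M s)) s.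
Proof.
move=> sn; have sz : size s = n by rewrite (perm_size sn) size_iota.
have us : uniq s by rewrite (perm_uniq sn) iota_uniq.
move/(compatibleP M sz) => compat; apply/(sortedP 0) => j; rewrite sz => jn.
have lt_nth i : i < n -> nth 0 s i < n.
  by move=> ?; rewrite -[_ < n](mem_iota 0 n) -(perm_mem sn) mem_nth ?sz.
have le_M : nth 0 M j <= nth 0 M j.+1 by apply: (sortedP 0 M_sorted); rewrite M_size.
rewrite /stable_le !(nth_label M sz) ?lt_nth ?(ltnW jn) // !index_uniq ?sz ?(ltnW jn) //.
by have := compat j jn; lia.
Qed.

(** By [compatible_sorted], [s] is the stable sorting permutation of its word. *)
Lemma label_inj s s' :
    perm_eq s (iota 0 n) -> perm_eq s' (iota 0 n) ->
    compatible M s -> compatible M s' ->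
  label M s = label M s' -> s = s'.
Proof.
move=> sn sn' cs cs' eq_l.
apply: (sorted_eq (@stable_le_trans (label M s)) (@stable_le_anti _)).
- exact: compatible_sorted.
- by rewrite eq_l; apply: compatible_sorted.
- by rewrite (perm_trans sn) // perm_sym.
Qed.

Lemma perm_label s : perm_eq s (iota 0 n) -> perm_eq (label M s) M.
Proof.
move=> sn; have sz : size s = n by rewrite (perm_size sn) size_iota.
have us : uniq s by rewrite (perm_uniq sn) iota_uniq.
rewrite /label sz -[X in perm_eq _ X](mkseq_nth 0) /mkseq M_size.
rewrite (map_comp (nth 0 M) (index^~ s)) perm_map //.
rewrite perm_sym in sn; apply: perm_trans (perm_map _ sn) _.
rewrite (_ : map _ s = iota 0 n) //; apply: (@eq_from_nth _ 0).
  by rewrite size_map size_iota.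
move=> i; rewrite size_map => i_s.
by rewrite (nth_map 0) // index_uniq // nth_iota // -sz.
Qed.

Lemma label_surj u : perm_eq u M ->
  exists s, [/\ perm_eq s (iota 0 n), compatible M s & label M s = u].
Proof.
move=> uM; have un : size u = n by rewrite (perm_size uM).
pose s := sort (stable_le u) (iota 0 n).
have sn : perm_eq s (iota 0 n) by rewrite perm_sort.
have sz : size s = n by rewrite (perm_size sn) size_iota.
have s_sorted : sorted (stable_le u) s by apply: sort_sorted; apply: stable_le_total.
have us : map (nth 0 u) s = M.
  apply: (sorted_eq leq_trans anti_leq) => //.
    rewrite sorted_map; apply: sub_sorted s_sorted => x y /=.
    by rewrite /stable_le; lia.
  apply: perm_trans (perm_map _ sn) _.
  by rewrite -un -[map _ _]/(mkseq _ _) mkseq_nth.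
have nthM j : j < n -> nth 0 M j = nth 0 u (nth 0 s j).
  by move=> jn; rewrite -us (nth_map 0) ?sz.
exists s; split=> //.
  apply/(compatibleP M sz) => j jn; rewrite !nthM // ?(ltnW jn) //.
  by have := sortedP 0 s_sorted j; rewrite sz /stable_le => /(_ jn); lia.
apply: (@eq_from_nth _ 0) => [|i]; first by rewrite size_map size_iota sz.
rewrite size_map size_iota sz => i_n; rewrite (nth_label M sz) //.
have i_s : i \in s by rewrite (perm_mem sn) mem_iota.
by rewrite nthM ?nth_index // -sz index_mem.
Qed.

(** For two positions [x < y] of the word, the letters weakly increase exactly
    when [x] precedes [y] in [s], because [s] sorts the word stably. *)
Lemma avoids_label dec k s : perm_eq s (iota 0 n) -> compatible M s ->
  avoids (monotone dec) k (label M s) = avoids (monotone dec) k s.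
Proof.
move=> sn cs; have sz : size s = n by rewrite (perm_size sn) size_iota.
have ss := compatible_sorted sn cs.
rewrite (avoids_inverse _ _ sn) /label sz avoids_map.
have same_order x y : x < y -> y < n ->
    (nth 0 M (index x s) <= nth 0 M (index y s)) = (index x s <= index y s).
  move=> xy yn; have xn := ltn_trans xy yn.
  have [xs ys] : x \in s /\ y \in s by rewrite !(perm_mem sn) !mem_iota.
  have le_stable := sorted_leq_index (@stable_le_trans _) _ ss.
  have refl : reflexive (stable_le (label M s)) by move=> ?; rewrite /stable_le; lia.
  apply/idP/idP; last first.
    by move/(le_stable refl _ _ xs ys); rewrite /stable_le !(nth_label M sz) //; lia.
  apply: contraTT; rewrite -ltnNge => /ltnW /(le_stable refl _ _ ys xs).
  by rewrite /stable_le !(nth_label M sz) //; lia.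
congr (~~ _); apply/asboolP/asboolP => -[t [st ts tk]]; exists t; split=> //.
all: move: (ts); rewrite subseq_iota => /andP[t_inc /allP t_n].
all: apply/(sortedP 0) => i lt_i; have := sortedP 0 st i lt_i.
all: by rewrite /= /by_rank /monotone same_order //;
  [exact: (sortedP 0 t_inc) | exact/t_n/mem_nth].
Qed.
End Standardization.

(** * Permutations and monotone patterns *)

Definition entries n (s : 'S_n) : seq nat := [seq (s i : nat) | i <- enum 'I_n].

Lemma size_entries n (s : 'S_n) : size (entries s) = n.
Proof. by rewrite size_map size_enum_ord. Qed.

Lemma nth_entries n (s : 'S_n) (i : 'I_n) : nth 0 (entries s) i = s i.
Proof. by rewrite (nth_map i) ?size_enum_ord // nth_ord_enum. Qed.

Lemma perm_entries n (s : 'S_n) : perm_eq (entries s) (iota 0 n).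
Proof.
apply: uniq_perm; [|exact: iota_uniq|].
  by rewrite map_inj_uniq ?enum_uniq // => i j /val_inj/perm_inj.
move=> x; rewrite mem_iota /=; apply/mapP/idP => [[i _ ->]|xn]; first exact: ltn_ord.
by exists (s^-1%g (Ordinal xn)); rewrite ?mem_enum // permKV.
Qed.

Lemma entries_inj n : injective (@entries n).
Proof. by move=> s s' e; apply/permP => i; apply/val_inj; rewrite /= -!nth_entries e. Qed.

Lemma entries_surj n v : perm_eq v (iota 0 n) -> exists s : 'S_n, entries s = v.
Proof.
move=> vn; have sz : size v = n by rewrite (perm_size vn) size_iota.
have lt_v (i : 'I_n) : nth 0 v i < n.
  by rewrite -[_ < n](mem_iota 0 n) -(perm_mem vn) mem_nth ?sz.
have inj : injective (fun i => Ordinal (lt_v i)).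
  move=> i j /(congr1 val) /= /eqP; rewrite nth_uniq ?sz // ?(perm_uniq vn) ?iota_uniq //.
  by move/eqP/val_inj.
exists (perm inj); apply: (@eq_from_nth _ 0) => [|i]; rewrite size_entries ?sz // => i_n.
by rewrite -[i]/(val (Ordinal i_n)) nth_entries permE.
Qed.

Lemma wordE n (s : 'S_n) : word s = map S (entries s).
Proof. by rewrite /entries -map_comp. Qed.

Lemma size_word n (s : 'S_n) : size (word s) = n.
Proof. by rewrite wordE size_map size_entries. Qed.

Lemma size_standardize t : size (standardize t) = size t.
Proof. by rewrite size_map. Qed.

Lemma sorted_mapS dec t : sorted (monotone dec) (map S t) = sorted (monotone dec) t.
Proof. by rewrite sorted_map; apply: eq_sorted. Qed.

Definition monotone_pattern (dec : bool) k : permutation :=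
  if dec then decreasing k else increasing k.

Lemma word_monotone_pattern dec k :
  word (tagged (monotone_pattern dec k)) =
  if dec then rev (map S (iota 0 (tag (monotone_pattern dec k))))
  else map S (iota 0 (tag (monotone_pattern dec k))).
Proof.
case: dec; rewrite wordE -?map_rev; congr map; apply: (@eq_from_nth _ 0) => [|i]; 
  rewrite size_entries ?size_rev ?size_iota //= => ik.
  rewrite -[i]/(val (Ordinal ik)) nth_entries permE nth_rev ?size_iota //= nth_iota; lia.
by apply: etrans (nth_entries _ (Ordinal ik)) _; rewrite perm1 nth_iota.
Qed.

(** A sequence is determined by its sorted version and its standardization, so
    it standardizes to the monotone word only if it is its own sorted version, up
    to reversal. *)
Lemma standardize_dir dec t : uniq t ->
  standardize t = (if dec then rev (map S (iota 0 (size t))) else map S (iota 0 (size t)))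
  <-> sorted (monotone dec) t.
Proof.
move=> ut; have us : uniq (sort leq t) by rewrite sort_uniq.
have idx : map (fun x => (index x (sort leq t)).+1) (sort leq t) = map S (iota 0 (size t)).
  apply: (@eq_from_nth _ 0); rewrite !size_map ?size_iota ?size_sort // => i it.
  by rewrite [RHS](nth_map 0) ?size_iota // [LHS](nth_map 0) ?size_sort //
    index_uniq ?size_sort // nth_iota.
have dirE : sorted (monotone dec) t <-> t = if dec then rev (sort leq t) else sort leq t.
  split=> [st|->].
    have: (if dec then rev t else t) = sort leq t.
      apply: (sorted_eq leq_trans anti_leq).
      - by move: st; rewrite sorted_monotone // ltn_sorted_uniq_leq => /andP[].
      - by apply: sort_sorted; apply: leq_total.
      - by case: (dec); rewrite ?perm_rev perm_sym perm_sort.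
    by case: (dec) => [<-|]; rewrite ?revK.
  rewrite sorted_monotone; last by case: (dec); rewrite ?rev_uniq.
  have -> : (if dec then rev (if dec then rev (sort leq t) else sort leq t)
             else if dec then rev (sort leq t) else sort leq t) = sort leq t.
    by case: (dec); rewrite ?revK.
  by rewrite ltn_sorted_uniq_leq us sort_sorted //; apply: leq_total.
rewrite dirE /standardize -idx.
have -> : (if dec then rev (map (fun x => (index x (sort leq t)).+1) (sort leq t))
   else map (fun x => (index x (sort leq t)).+1) (sort leq t)) =
   map (fun x => (index x (sort leq t)).+1) (if dec then rev (sort leq t) else sort leq t).
  by case: (dec); rewrite ?map_rev.
split=> [e|e]; last by rewrite -e.
have restore v : {subset v <= sort leq t} ->
    map (fun i => nth 0 (sort leq t) i.-1) (map (fun x => (index x (sort leq t)).+1) v) = v.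
  move=> vt; rewrite -map_comp -[RHS]map_id; apply/eq_in_map => x /vt xt.
  by rewrite /= nth_index.
have := congr1 (map (fun i => nth 0 (sort leq t) i.-1)) e.
by rewrite !restore // => x; rewrite ?mem_dir ?mem_sort.
Qed.

Lemma contains_monotone n (s : 'S_n) dec k :
  contains s (tagged (monotone_pattern dec k)) <-> ~~ avoids (monotone dec) k (entries s).
Proof.
have us : uniq (entries s) by rewrite (perm_uniq (perm_entries s)) iota_uniq.
have tagE : tag (monotone_pattern dec k) = k by case: (dec).
rewrite /avoids negbK; split.
  case=> t; rewrite wordE => /subseqP[m _ ->]; rewrite -map_mask.
  set t0 := mask m _; have ut0 : uniq t0 by apply: mask_uniq.
  move=> st; apply/asboolP; exists t0.
  have sz : size t0 = k.
    by have := congr1 size st; rewrite size_word size_standardize size_map => ->.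
  split=> //; last exact: mask_subseq.
  rewrite -sorted_mapS; apply/(standardize_dir dec).
    by rewrite map_inj_uniq // => x y [].
  by rewrite st word_monotone_pattern tagE size_map sz.
case/asboolP => t [st ts tk]; exists (map S t); first by rewrite wordE map_subseq.
rewrite word_monotone_pattern tagE -tk -(size_map S t); apply/standardize_dir.
  by rewrite map_inj_uniq; [exact: (subseq_uniq ts)|move=> x y []].
by rewrite sorted_mapS.
Qed.

Lemma contains_same_size k (s p : 'S_k) : contains s p <-> s = p.
Proof.
have std : standardize (word s) = word s.
  have sortE : sort leq (word s) = iota 1 k.
    apply: (sorted_eq leq_trans anti_leq).
    - by apply: sort_sorted; apply: leq_total.
    - exact: iota_sorted.
    - by rewrite perm_sort wordE (iotaDl 1 0) perm_map // perm_entries.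
  rewrite /standardize sortE -[RHS]map_id; apply/eq_in_map => x.
  rewrite -(mem_sort leq) sortE mem_iota add1n ltnS => /andP[x0 xk].
  have e : nth 0 (iota 1 k) x.-1 = x by rewrite nth_iota; lia.
  by rewrite -{1}e index_uniq ?iota_uniq ?size_iota; lia.
have word_inj (q : 'S_k) : word s = word q -> s = q.
  by rewrite !wordE => /(inj_map succn_inj)/entries_inj.
split=> [[t ts tp]|<-]; last by exists (word s).
apply: word_inj; rewrite -std -tp; congr standardize.
apply/esym/eqP; rewrite -(size_subseq_leqif ts).
by have := congr1 size tp; rewrite size_standardize !size_word => ->.
Qed.

(** The bijection [label] carries one family to the other. *)
Lemma card_avoiding dec k n M : sorted leq M -> size M = n ->
  #|[set s : 'S_n | compatible M (entries s) && avoids (monotone dec) k (entries s)]%SET|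
  = num_avoiding (monotone dec) k M.
Proof.
move=> sM zM; rewrite cardE /num_avoiding -size_filter -(size_map (label M \o @entries n)).
apply: perm_size; apply: uniq_perm.
- rewrite map_inj_in_uniq ?enum_uniq // => s s'; rewrite !mem_enum !inE => /andP[cs _] /andP[cs' _].
  by move/(label_inj sM zM (perm_entries s) (perm_entries s') cs cs')/entries_inj.
- by rewrite filter_uniq // permutations_uniq.
move=> u; rewrite mem_filter mem_permutations; apply/mapP/andP.
  case=> s; rewrite mem_enum inE => /andP[cs av] ->.
  by rewrite /= (avoids_label sM zM _ _ (perm_entries s)) // (perm_label zM) // perm_entries.
case=> av /(label_surj sM zM)[v [vn cv lv]]; have [s sv] := entries_surj vn.
exists s; rewrite /= ?sv ?lv // mem_enum inE sv cv.
by rewrite -(avoids_label sM zM dec k vn cv) lv.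
Qed.

(** * Coefficients of the pattern quasisymmetric functions *)

Section Series.
Local Open Scope mset_scope.
Local Open Scope classical_set_scope.

Lemma compatible_Des n (s : 'S_n) M :
  reflect (forall j, j \in Des s -> nth 0 M j < nth 0 M j.+1) (compatible M (entries s)).
Proof.
have nth_word i : i < n -> nth 0 (word s) i = (nth 0 (entries s) i).+1.
  by move=> i_n; rewrite wordE (nth_map 0) ?size_entries.
apply: (iffP (compatibleP M (size_entries s))) => [H j|H j jn desc].
  rewrite inE !nth_word; [|by have := ltn_ord j; lia..].
  by rewrite ltnS; apply: H; have := ltn_ord j; lia.
have jn' : j < n.-1 by lia.
by apply: (H (Ordinal jn')); rewrite inE !nth_word //= ltnW.
Qed.

Section Coefficients.
Import GRing.Theory Num.Theory.
Local Open Scope ring_scope.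

Lemma fundamental_coef (R : realType) n (s : 'S_n) m :
  fundamental R n (Des s) m =
  ((size m == n) && compatible (sort leq m) (entries s))%:R.
Proof.
rewrite /fundamental; have [sz|sz] /= := eqVneq (size m) n; last first.
  apply: fsbig1 => i _; apply/eqP; rewrite pnatr_eq0 eqb0; apply: contraNneq sz => <-.
  by rewrite (perm_size (perm_eq_seq_mset i)) size_tuple.
have tP : size (sort leq m) == n by rewrite size_sort sz.
pose t := Tuple tP.
have support (i : n.-tuple nat) : fund_indices n (Des s) i -> i != t ->
    (seq_mset i == m)%:R = 0 :> R.
  case=> i_sorted _ i_t; apply/eqP; rewrite pnatr_eq0 eqb0; apply: contra i_t => /eqP im.
  apply/eqP/val_inj/(sorted_eq leq_trans anti_leq) => //=.
    by apply: sort_sorted; apply: leq_total.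
  by rewrite perm_sym perm_sort -im perm_eq_seq_mset.
have [/compatible_Des compat|incompat] := boolP (compatible _ _).
  rewrite (fsbigE [:: t]) //=; last 2 first.
  - move=> i /= ; rewrite inE => /eqP->; split=> //.
    by apply: sort_sorted; apply: leq_total.
  - by move=> i Ai; rewrite inE; apply: support.
  rewrite big_cons big_nil ifT ?addr0.
    rewrite (_ : _ == m) //; apply/eqP.
    rewrite -[RHS]seq_mset_id; apply/eq_seq_msetP.
    by rewrite /= perm_sort.
  by rewrite inE; split=> //; apply: sort_sorted; apply: leq_total.
apply: fsbig1 => i Ai; apply: support => //; apply: contraNneq incompat => it.
by apply/compatible_Des; case: Ai; rewrite it.
Qed.

Definition compatible_avoiders n (Pi : set permutation) M : {set 'S_n} :=
  [set s | compatible M (entries s) && `[< avoiders n Pi s >]]%SET.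

Lemma pattern_qsym_coef (R : realType) n (Pi : set permutation) m :
  pattern_qsym R n Pi m =
  (if size m == n then #|compatible_avoiders n Pi (sort leq m)| else 0%N)%:R.
Proof.
rewrite /pattern_qsym.
rewrite (fsbigE [seq s <- enum 'S_n | `[< avoiders n Pi s >]]); last 3 first.
- by rewrite filter_uniq ?enum_uniq.
- by move=> s /=; rewrite mem_filter => /andP[/asboolP].
- by move=> s As; rewrite mem_filter mem_enum andbT => /negP[]; apply/asboolP.
under eq_bigr do rewrite fundamental_coef.
rewrite -natr_sum; congr (_%:R); rewrite big_filter_cond big_enum_cond /=.
case: eqVneq => _ /=; last by rewrite big1.
rewrite -sum1_card [LHS]big_mkcond [RHS]big_mkcond; apply: eq_bigr => s _.
rewrite inE andbC; have [As|nAs] := boolP `[< avoiders n Pi s >].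
  by rewrite mem_set; [case: compatible|exact/asboolP].
by rewrite !andbF.
Qed.

End Coefficients.

Lemma avoiders_monotone n dec k M : sorted leq M -> size M = n ->
  #|compatible_avoiders n [set monotone_pattern dec k] M| = num_avoiding (monotone dec) k M.
Proof.
move=> sM zM; rewrite -(card_avoiding dec k sM zM); apply: eq_card => s; rewrite !inE.
congr (_ && _); apply/asboolP/idP => [av|av p ->].
  apply: contrapT => /negP na; apply: (av _ erefl); exact/contains_monotone.
by move=> /contains_monotone/negP; apply.
Qed.

Lemma size_rename_vars w (m : {mset nat}) : size (rename_vars w m) = size m.
Proof. by rewrite (perm_size (perm_eq_seq_mset _)) size_map. Qed.

Lemma perm_rename_vars w (m : {mset nat}) :
  perm_eq (sort leq (rename_vars w m)) (map w (sort leq m)).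
Proof.
rewrite perm_sort (perm_trans (perm_eq_seq_mset _)) // perm_map //.
by rewrite perm_sym perm_sort.
Qed.

Lemma num_avoiding_perm (T : eqType) (r : rel T) k s t :
  perm_eq s t -> num_avoiding r k s = num_avoiding r k t.
Proof. by move=> st; apply/seq.permP/perm_permutations. Qed.

Lemma pattern_qsym_bounded (R : realType) n Pi : bounded_degree (pattern_qsym R n Pi).
Proof.
by exists n => m; rewrite pattern_qsym_coef; case: eqVneq => // ->; rewrite leqnn.
Qed.

Lemma symmetric_monotone (R : realType) n dec k :
  symmetric_function (pattern_qsym R n [set monotone_pattern dec k]).
Proof.
split; first exact: pattern_qsym_bounded.
move=> w /bij_inj w_inj m; rewrite !pattern_qsym_coef size_rename_vars.
case: eqVneq => // mn.
rewrite !avoiders_monotone ?size_sort ?size_rename_vars //;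
  try by apply: sort_sorted; apply: leq_total.
by rewrite (num_avoiding_perm _ _ (perm_rename_vars w m)) num_avoiding_rename.
Qed.

Lemma avoiders_long n k : n < k -> avoiders n [set increasing k] = [set: 'S_n].
Proof.
move=> nk; apply/seteqP; split=> // s _ p -> [t ts tk].
have := size_subseq ts; rewrite -size_standardize tk !size_word /=; lia.
Qed.

(** In size [n] the pattern [p] is avoided by all permutations except [p], and
    the increasing pattern of length [n + 1] by all of them. *)
Lemma card_compatible_avoiders1 n (p : 'S_n) M :
  #|compatible_avoiders n [set Tagged (fun j => 'S_j) p] M| + compatible M (entries p) =
  #|compatible_avoiders n [set increasing n.+1] M|.
Proof.
rewrite (cardsD1 p (compatible_avoiders n [set increasing n.+1] M)) addnC.
rewrite /compatible_avoiders avoiders_long //; congr (_ + _).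
  by rewrite !inE (_ : `[< _ >] = true) ?andbT //; apply/asboolP.
apply: eq_card => s; rewrite !inE (_ : `[< [set: 'S_n] s >] = true); last exact/asboolP.
rewrite andbT andbC; congr (_ && _); apply/asboolP/idP => [av|sp q ->].
  by apply/eqP => sp; apply: (av _ erefl); apply/contains_same_size.
by move/contains_same_size => /eqP; apply/negP.
Qed.

(** By [card_compatible_avoiders1], F_(Des p) is a difference of two symmetric
    functions. *)
Lemma symmetric_fundamental (R : realType) n (p : 'S_n) w (m : {mset nat}) :
    symmetric_function (pattern_qsym R n [set Tagged (fun j => 'S_j) p]) ->
    bijective w -> size m = n ->
  compatible (sort leq (rename_vars w m)) (entries p) = compatible (sort leq m) (entries p).
Proof.
case=> _ sym bw mn; have [_ symT] := symmetric_monotone R n false n.+1.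
have /eqP := sym w bw m; have /eqP := symT w bw m.
rewrite !pattern_qsym_coef size_rename_vars mn eqxx !Num.Theory.eqr_nat => /eqP eT /eqP ep.
have := card_compatible_avoiders1 p (sort leq (rename_vars w m)).
have := card_compatible_avoiders1 p (sort leq m).
rewrite -[increasing _]/(monotone_pattern false _) eT ep => <- /eqP.
by rewrite eqn_add2l => /eqP; do 2 case: compatible.
Qed.

(** For [j < n - 1] this is the word [0, 1, ..., j, j, j + 1, ..., n - 2]; in the
    subtraction, the boolean [j < i] counts as 0 or 1. *)
Definition repeat_at n j : seq nat := [seq i - (j < i) | i <- iota 0 n].

Lemma nth_repeat_at n j i : i < n -> nth 0 (repeat_at n j) i = i - (j < i).
Proof. by move=> i_n; rewrite (nth_map 0) ?size_iota // nth_iota. Qed.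

Lemma size_repeat_at n j : size (repeat_at n j) = n.
Proof. by rewrite size_map size_iota. Qed.

Lemma sorted_repeat_at n j : sorted leq (repeat_at n j).
Proof.
by apply/(sortedP 0) => i; rewrite size_repeat_at => i_n; rewrite !nth_repeat_at //; lia.
Qed.

(** The word [repeat_at n j] increases strictly everywhere except at [j]. *)
Lemma compatible_repeat_at n (p : 'S_n) (j : 'I_n.-1) :
  compatible (repeat_at n j) (entries p) = (j \notin Des p).
Proof.
have := ltn_ord j => jn.
apply/compatible_Des/idP => [H|jD i iD].
  by apply/negP => /H; rewrite !nth_repeat_at; lia.
have := ltn_ord i => i_n.
have ij : (i : nat) != j by apply: contraNneq jD => /val_inj <-.
by rewrite !nth_repeat_at; lia.
Qed.

Lemma perm_repeat_at n j : j.+1 < n -> perm_eq (repeat_at n j) (j :: iota 0 n.-1).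
Proof.
move=> jn; have nE : n = j.+1 + (n - j.+1) by lia.
rewrite /repeat_at {1}nE iotaD map_cat.
have -> : [seq i - (j < i) | i <- iota 0 j.+1] = iota 0 j.+1.
  rewrite -[RHS]map_id; apply/eq_in_map => i; rewrite mem_iota; lia.
have -> : [seq i - (j < i) | i <- iota (0 + j.+1) (n - j.+1)] = iota j (n - j.+1).
  rewrite add0n (iotaDl 1 j) -map_comp -[RHS]map_id; apply/eq_in_map => i.
  by rewrite mem_iota /=; lia.
have -> : n.-1 = j + (n - j.+1) by lia.
by rewrite iotaD -[j.+1]addn1 iotaD -catA -[j :: _]cat1s perm_catCA.
Qed.

Lemma perm_map_involutive n w : involutive w -> (forall x, x < n -> w x < n) ->
  perm_eq (map w (iota 0 n)) (iota 0 n).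
Proof.
move=> wK wn; apply: uniq_perm; rewrite ?(map_inj_uniq (inv_inj wK)) ?iota_uniq // => x.
rewrite mem_iota /=; apply/mapP/idP => [[y yn ->]|xn].
  by apply: wn; move: yn; rewrite mem_iota.
by exists (w x); rewrite ?wK // mem_iota /= wn.
Qed.

Lemma sort_seq_mset s : sorted leq s -> sort leq (seq_mset s) = s.
Proof.
move=> ss; apply: (sorted_eq leq_trans anti_leq) => //.
  by apply: sort_sorted; apply: leq_total.
by rewrite perm_sort perm_eq_seq_mset.
Qed.

(** Exchanging the variables [i] and [j] carries the monomial of [repeat_at n i]
    to that of [repeat_at n j]. *)
Lemma symmetric_Des (R : realType) n (p : 'S_n) (i j : 'I_n.-1) :
    symmetric_function (pattern_qsym R n [set Tagged (fun j => 'S_j) p]) ->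
  (i \in Des p) = (j \in Des p).
Proof.
move=> sym; apply: negb_inj; rewrite -!compatible_repeat_at.
pose w : nat -> nat := swap (i : nat) (j : nat).
have wK : involutive w := swapK (i : nat) (j : nat).
have := symmetric_fundamental (m := seq_mset (repeat_at n i)) sym (inv_bij wK).
rewrite (perm_size (perm_eq_seq_mset _)) size_repeat_at => /(_ erefl).
rewrite (sort_seq_mset (sorted_repeat_at _ _)) => <-; congr compatible.
apply: (sorted_eq leq_trans anti_leq).
- by apply: sort_sorted; apply: leq_total.
- exact: sorted_repeat_at.
rewrite (perm_trans (perm_rename_vars _ _)) //.
rewrite (sort_seq_mset (sorted_repeat_at _ _)).
have := ltn_ord i; have := ltn_ord j => jn i_n.
have i1 : i.+1 < n by lia.
have j1 : j.+1 < n by lia.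
rewrite (perm_trans (perm_map w (perm_repeat_at i1))) // perm_sym.
rewrite (perm_trans (perm_repeat_at j1)) // perm_sym /= [w i]/w {1}/swap eqxx perm_cons.
apply: perm_map_involutive => // x xn; rewrite /w /swap.
by case: eqP => _; [|case: eqP => _]; lia.
Qed.

Lemma monotone_of_Des n (p : 'S_n) dec :
  (forall j, (j \in Des p) = dec) -> Tagged (fun j => 'S_j) p = monotone_pattern dec n.
Proof.
move=> desp; suff: contains p (tagged (monotone_pattern dec n)).
  by case: (dec) => /contains_same_size ->.
apply/contains_monotone; rewrite negbK; apply/asboolP; exists (entries p).
rewrite size_entries; split=> //; apply/(sortedP 0) => i; rewrite size_entries => i_n.
have i_n1 : i < n.-1 by lia.
have := desp (Ordinal i_n1); rewrite inE /= wordE.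
rewrite !(nth_map 0) ?size_entries // ?(ltnW i_n) // => e.
rewrite /monotone leqNgt -ltnS e; by case: (dec).
Qed.
End Series.

Unset Implicit Arguments.

Local Open Scope classical_set_scope.

Theorem theorem2p2 (R : realType) (Pi : set permutation)
    (hPi : (Pi #= `I_1)%card) :
  (forall n : nat, symmetric_function (pattern_qsym R n Pi)) <->
  (exists k : nat, Pi = [set increasing k] \/ Pi = [set decreasing k]).
Proof.
split=> [sym|[k [->|->]] n]; last 2 first.
- exact: (symmetric_monotone R n false k).
- exact: (symmetric_monotone R n true k).
have /eq_cardSP[[k p] Pip empty] := hPi.
have PiE : Pi = [set Tagged (fun j => 'S_j) p].
  apply/seteqP; split=> [q Piq|_ ->//]; have [//|qp] := pselect (q = Tagged (fun j => 'S_j) p).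
  have : (Pi `\ Tagged (fun j => 'S_j) p) q by split.
  by move: empty; rewrite II0 card_eq0 => /eqP ->.
exists k; have := sym k; rewrite PiE => symp.
have [j _|none] := pickP 'I_k.-1; last first.
  by left; rewrite (monotone_of_Des (dec := false)) // => j; have := none j.
have desp i : (i \in Des p) = (j \in Des p) by apply: symmetric_Des symp.
case: (j \in Des p) desp => desp; [right|left].
  by rewrite (monotone_of_Des (dec := true)).
by rewrite (monotone_of_Des (dec := false)).
Qed.
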